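(* Let $C$ be an arbitrary Boolean circuit (built from $\neg,\vee,\wedge$) with $n$ input variables $p_1,\ldots,p_n$ and one output. Let $p,q_1,\ldots,q_n$ be $n+1$ fresh variables. Let $h(C)$ be the circuit obtained from $C$ by replacing every input variable $p_i$ by $p_i \wedge q_i$, let $D = (\bigwedge_{i=1}^n p_i) \wedge (\bigwedge_{i=1}^n \neg q_i)$, and let \[ F(C) = (p \vee (h(C) + D)) \wedge (\neg p \vee D), \] a circuit in the $2n+1$ variables $p,p_1,\ldots,p_n,q_1,\ldots,q_n$. Let $f : \{0,1\}^{2n+1} \to \{0,1\}$ be the function computed by $F(C)$ (coordinates of $\{0,1\}^{2n+1}$ identified with these $2n+1$ variables). Then $C$ is unsatisfiable if and only if there exists $s \in \{0,1\}^{2n+1}$ with $s \neq \overline{0}$ and $s \in V(f)$.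
   Context: $+$ denotes exclusive or (addition modulo 2) on $\{0,1\}$, and for vectors $x,y \in \{0,1\}^k$, $x+y$ is the coordinatewise exclusive or. $\overline{0}$ is the all-zero vector. For a function $f : \{0,1\}^k \to \{0,1\}^m$, $V(f) = \{ s \in \{0,1\}^k \mid \forall x \in \{0,1\}^k : f(x+s) = f(x)\}$. A circuit with one output is satisfiable if some assignment of Boolean values to its inputs makes the output true. In a formula/circuit, $A + B$ abbreviates $(A \wedge \neg B) \vee (\neg A \wedge B)$. *)

(* Defs.v *)
From HB Require Import structures.
From mathcomp Require Import all_boot all_algebra.
Set Implicit Arguments.
Unset Strict Implicit.
Unset Printing Implicit Defensive.
Local Open Scope ring_scope.

(* Bit vectors: as [bool] carries the field structure whose addition is [addb],
   the pointwise [+] on [bits k] is the coordinatewise exclusive or, and [0] is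
   the all-zero vector. *)
Notation bits k := {ffun 'I_k -> bool}.

(* The codomain is any [eqType], which covers both [bool] and [bits m]. *)
Definition V (k : nat) (T : eqType) (f : bits k -> T) : {set bits k} :=
  [set s | [forall x : bits k, f (x + s) == f x]].

Inductive gate (X : Type) : Type :=
  | Not of X
  | Or of X & X
  | And of X & X.

(* One-output circuits with arbitrary fan-out, as gates listed in topological
   order.  [X] is the type of the wires available so far, initially the input
   variables: [Output x] outputs the wire [x], and [Gate g c] adds a gate [g]
   fed by wires in [X], whose output is the wire [None] of [c] (the earlier
   wires are renamed by [Some]).  A wire may be used any number of times. *)
Inductive circuit (X : Type) : Type :=
  | Output of X
  | Gate of gate X & circuit (option X).

Definition gate_eval (X : Type) (v : X -> bool) (g : gate X) : bool :=
  match g with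
  | Not x => ~~ v x
  | Or x y => v x || v y
  | And x y => v x && v y
  end.

Fixpoint eval (X : Type) (v : X -> bool) (c : circuit X) : bool :=
  match c with
  | Output x => v x
  | Gate g c' => eval (oapp v (gate_eval v g)) c'
  end.

Definition satisfiable (X : Type) (c : circuit X) : Prop :=
  exists v : X -> bool, eval v c.

Definition computed (k : nat) (c : circuit 'I_k) : bits k -> bool :=
  fun x => eval x c.

Definition gate_map (X Y : Type) (r : X -> Y) (g : gate X) : gate Y :=
  match g with
  | Not x => Not (r x)
  | Or x y => Or (r x) (r y)
  | And x y => And (r x) (r y)
  end.

Fixpoint rename (X Y : Type) (r : X -> Y) (c : circuit X) : circuit Y :=
  match c with
  | Output x => Output (r x)
  | Gate g c' => Gate (gate_map r g) (rename (omap r) c')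
  end.

(* Runs [c], then [d], in which the wire [None] is the output of [c]. *)
Fixpoint plug (X : Type) (c : circuit X) (d : circuit (option X)) :
    circuit X :=
  match c with
  | Output x => rename (odflt x) d
  | Gate g c' => Gate g (plug c' (rename (omap Some) d))
  end.

Definition cnot (X : Type) (c : circuit X) : circuit X :=
  plug c (Gate (Not None) (Output None)).

Definition cor (X : Type) (c d : circuit X) : circuit X :=
  plug c (plug (rename Some d)
    (Gate (Or (Some None) None) (Output None))).

Definition cand (X : Type) (c d : circuit X) : circuit X :=
  plug c (plug (rename Some d)
    (Gate (And (Some None) None) (Output None))).

Definition cxor (X : Type) (c d : circuit X) : circuit X :=
  cor (cand c (cnot d)) (cand (cnot c) d).

(* Conjunction of a nonempty list; [c0] is a dummy value for the empty list,
   since without constant gates no circuit denotes the empty conjunction. *)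
Fixpoint bigand (X : Type) (c0 : circuit X) (s : seq (circuit X)) :
    circuit X :=
  match s with
  | [::] => c0
  | [:: c] => c
  | c :: s' => cand c (bigand c0 s')
  end.

Definition gate_subst (X Y : Type) (r : X -> circuit Y) (g : gate X) :
    circuit Y :=
  match g with
  | Not x => cnot (r x)
  | Or x y => cor (r x) (r y)
  | And x y => cand (r x) (r y)
  end.

(* Replaces each use of an input variable [x] by the circuit [r x]; the gates
   of [c] themselves are not duplicated. *)
Fixpoint subst (X Y : Type) (r : X -> circuit Y) (c : circuit X) : circuit Y :=
  match c with
  | Output x => r x
  | Gate g c' =>
      plug (gate_subst r g)
        (subst (fun o : option X =>
                  if o is Some x then rename Some (r x) else Output None) c')
  end.

(* The variables p, p_1, ..., p_n, q_1, ..., q_n, in this order, are the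
   coordinates 0, ..., 2n. *)
Definition var_p (n : nat) : 'I_(n + n).+1 := ord0.
Definition var_pi (n : nat) (i : 'I_n) : 'I_(n + n).+1 :=
  lift ord0 (lshift n i).
Definition var_qi (n : nat) (i : 'I_n) : 'I_(n + n).+1 :=
  lift ord0 (rshift n i).

Definition h (n : nat) (C : circuit 'I_n) : circuit 'I_(n + n).+1 :=
  subst (fun i => cand (Output (var_pi i)) (Output (var_qi i))) C.

(* Only meaningful for [0 < n], which holds as soon as there is a circuit on
   ['I_n]: see [circuit_gt0]. *)
Definition D (n : nat) : circuit 'I_(n + n).+1 :=
  let c0 := Output (var_p n) in
  cand (bigand c0 [seq Output (var_pi i) | i <- enum 'I_n])
       (bigand c0 [seq cnot (Output (var_qi i)) | i <- enum 'I_n]).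

Definition F (n : nat) (C : circuit 'I_n) : circuit 'I_(n + n).+1 :=
  let p := Output (var_p n) in
  cand (cor p (cxor (h C) (D n))) (cor (cnot p) (D n)).

Lemma circuit_gt0 (n : nat) (C : circuit 'I_n) : (0 < n)%N.
Proof. by case: C => [|[]] i *; apply: leq_ltn_trans (ltn_ord i). Qed.

(* Main.v *)
Require Import Defs.
From mathcomp Require Import all_boot all_algebra.
Local Open Scope ring_scope.

(* With d the indicator of "all p_i true, all q_i false", the function f is d
   on the half cube p = 1 and C(p_i && q_i) (+) d on p = 0.  If C is
   unsatisfiable then f = d ignores p, so the unit vector of p is a period.
   Otherwise let s be a period.  Each half cube has a single point satisfying
   d, so s = 0 if s fixes p.  If s flips p, it injects the points with p = 0
   and f = 1 into the single such point with p = 1; but there are at least two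
   of the former: (0, 0) and (0, 1) if C holds at 0, and (1, 0) and (v, v)
   if C fails at 0 and v satisfies C. *)

Import GRing.Theory.

Lemma eval_ext {X : Type} {v w : X -> bool} (c : circuit X) :
  v =1 w -> eval v c = eval w c.
Proof.
elim: c v w => {X} [X x|X g c IHc] v w eq_vw //=.
apply: IHc => -[x|] //=.
by case: g => [x|x y|x y] /=; rewrite !eq_vw.
Qed.

Lemma eval_rename {X Y : Type} (v : Y -> bool) (r : X -> Y) (c : circuit X) :
  eval v (rename r c) = eval (v \o r) c.
Proof.
elim: c Y v r => {X} [X x|X g c IHc] Y v r //=.
by rewrite IHc; apply: eval_ext => -[x|] //=; case: g.
Qed.

Lemma eval_plug {X : Type} (v : X -> bool) (c : circuit X)
    (d : circuit (option X)) :
  eval v (plug c d) = eval (oapp v (eval v c)) d.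
Proof.
elim: c v d => {X} [X x|X g c IHc] v d /=.
  by rewrite eval_rename; apply: eval_ext => -[].
by rewrite IHc eval_rename; apply: eval_ext => -[].
Qed.

Lemma eval_cnot {X : Type} (v : X -> bool) (c : circuit X) :
  eval v (cnot c) = ~~ eval v c.
Proof. by rewrite /cnot eval_plug. Qed.

Lemma eval_cor {X : Type} (v : X -> bool) (c d : circuit X) :
  eval v (cor c d) = eval v c || eval v d.
Proof. by rewrite /cor !eval_plug /= eval_rename. Qed.

Lemma eval_cand {X : Type} (v : X -> bool) (c d : circuit X) :
  eval v (cand c d) = eval v c && eval v d.
Proof. by rewrite /cand !eval_plug /= eval_rename. Qed.

Lemma eval_cxor {X : Type} (v : X -> bool) (c d : circuit X) :
  eval v (cxor c d) = eval v c (+) eval v d.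
Proof.
by rewrite /cxor eval_cor !eval_cand !eval_cnot; do 2!case: (eval v _).
Qed.

Lemma eval_bigand {X : Type} (v : X -> bool) (c0 : circuit X)
    (s : seq (circuit X)) :
  (0 < size s)%N -> eval v (bigand c0 s) = all (eval v) s.
Proof.
elim: s => // c [|d s] IHs _; first by rewrite /= andbT.
by rewrite [bigand _ _]/(cand c (bigand c0 (d :: s))) eval_cand IHs.
Qed.

Lemma eval_subst {X Y : Type} (v : Y -> bool) (r : X -> circuit Y)
    (c : circuit X) :
  eval v (subst r c) = eval (fun x => eval v (r x)) c.
Proof.
elim: c Y v r => {X} [X x|X g c IHc] Y v r //=.
rewrite eval_plug IHc; apply: eval_ext => -[x|] /=.
  by rewrite eval_rename; apply: eval_ext.
by case: g => [x|x y|x y] /=; rewrite ?eval_cnot ?eval_cor ?eval_cand.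
Qed.

(** The indicator d, stated without circuits so that it does not involve the dummy value of
    [bigand]. *)
Definition all_p_no_q {n : nat} (x : bits (n + n).+1) : bool :=
  [forall i : 'I_n, x (var_pi i)] && [forall i : 'I_n, ~~ x (var_qi i)].

Lemma eval_D {n : nat} (x : bits (n + n).+1) :
  (0 < n)%N -> eval x (D n) = all_p_no_q x.
Proof.
move=> n_gt0; rewrite /D eval_cand !eval_bigand 1?size_map ?size_enum_ord //.
congr (_ && _); rewrite all_map.
  apply/allP/forallP => [x1 i|x1 i _]; last exact: x1.
  by have := x1 i; rewrite mem_enum; apply.
apply/allP/forallP => [x0 i|x0 i _].
  by have := x0 i; rewrite mem_enum; apply.
exact: x0.
Qed.

(** The variable p acts as a switch: when true it satisfies the first clause of [F C] and leaves d,
    when false it satisfies the second and leaves the exclusive or. *)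
Lemma computed_F {n : nat} (C : circuit 'I_n) (x : bits (n + n).+1) :
  computed (F C) x =
  if x (var_p n) then all_p_no_q x
  else eval (fun i => x (var_pi i) && x (var_qi i)) C (+) all_p_no_q x.
Proof.
rewrite /computed /F eval_cand eval_cor eval_cxor eval_cor eval_cnot /=.
rewrite (eval_D _ (circuit_gt0 C)) /h eval_subst.
have ->: eval (fun i => eval x (cand (Output (var_pi i)) (Output (var_qi i)))) C
    = eval (fun i => x (var_pi i) && x (var_qi i)) C.
  by apply: eval_ext => i; rewrite eval_cand.
by case: (x _); rewrite //= andbT.
Qed.

Lemma bits_ext {n : nat} (x y : bits (n + n).+1) :
  x (var_p n) = y (var_p n) -> (forall i : 'I_n, x (var_pi i) = y (var_pi i)) ->
  (forall i : 'I_n, x (var_qi i) = y (var_qi i)) -> x = y.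
Proof.
move=> eq_p eq_pi eq_qi; apply/ffunP => k.
have [j ->|->] := unliftP ord0 k; last exact: eq_p.
by rewrite -(splitK j); case: (split j).
Qed.

(** The condition d prescribes every coordinate other than p. *)
Lemma all_p_no_q_inj {n : nat} (x y : bits (n + n).+1) :
  all_p_no_q x -> all_p_no_q y -> x (var_p n) = y (var_p n) -> x = y.
Proof.
move=> /andP[/forallP x1 /forallP x0] /andP[/forallP y1 /forallP y0] eq_p.
apply: bits_ext => // i; first by rewrite x1 y1.
by rewrite (negbTE (x0 i)) (negbTE (y0 i)).
Qed.

(** Coordinates in the order p, p_i, q_i: [unlift ord0] strips p, and [split] separates the p_i from
    the q_i, inverting [var_pi] and [var_qi]. *)
Definition point {n : nat} (b : bool) (u w : 'I_n -> bool) : bits (n + n).+1 :=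
  [ffun k => if unlift ord0 k is Some j then
               match split j with inl i => u i | inr i => w i end
             else b].

Lemma point_p {n : nat} b (u w : 'I_n -> bool) : point b u w (var_p n) = b.
Proof. by rewrite ffunE unlift_none. Qed.

Lemma point_pi {n : nat} b (u w : 'I_n -> bool) i :
  point b u w (var_pi i) = u i.
Proof. by rewrite ffunE liftK (unsplitK (inl i)). Qed.

Lemma point_qi {n : nat} b (u w : 'I_n -> bool) i :
  point b u w (var_qi i) = w i.
Proof. by rewrite ffunE liftK (unsplitK (inr i)). Qed.

Definition pointE := (@point_p, @point_pi, @point_qi).

Lemma all_p_no_q_point {n : nat} b (u w : 'I_n -> bool) :
  all_p_no_q (point b u w) = [forall i, u i] && [forall i, ~~ w i].
Proof.
by congr (_ && _); apply: eq_forallb => i; rewrite pointE.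
Qed.

Lemma computed_F_point0 {n : nat} (C : circuit 'I_n) (u w : 'I_n -> bool) :
  computed (F C) (point false u w) =
  eval (fun i => u i && w i) C (+) ([forall i, u i] && [forall i, ~~ w i]).
Proof.
rewrite computed_F all_p_no_q_point point_p; congr (_ (+) _).
by apply: eval_ext => i; rewrite !pointE.
Qed.

Lemma computed_F_two_points {n : nat} (C : circuit 'I_n) :
  satisfiable C -> exists x y : bits (n + n).+1,
    [/\ x != y, x (var_p n) = y (var_p n), x (var_p n) = false,
        computed (F C) x & computed (F C) y].
Proof.
(* The index [i0] shows that the two points differ and that d fails where it must; for n = 0 both
   could break down. *)
move=> [v Cv]; pose i0 := Ordinal (circuit_gt0 C).
case C0: (eval xpred0 C).
  (* With all p_i false, each p_i && q_i is false whatever q_i is, so C contributes 1 at both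
     points, while d is 0. *)
  exists (point false xpred0 xpred0), (point false xpred0 xpredT).
  have no_p : [forall i : 'I_n, false] = false.
    by apply/negP => /forallP/(_ i0).
  split; rewrite ?point_p // ?computed_F_point0 ?no_p ?addbF //.
  by apply/eqP => /ffunP/(_ (var_qi i0)); rewrite !pointE.
(* At the first point C contributes 0 and d is 1. At the second C is evaluated at v && v = v, and d
   would need [v i0] both true and false. *)
exists (point false xpredT xpred0), (point false v v).
split; rewrite ?point_p // ?computed_F_point0.
- apply/eqP => /ffunP eq_xy; have := eq_xy (var_pi i0).
  by have := eq_xy (var_qi i0); rewrite !pointE => <-.
- rewrite C0 /=; apply/andP; split; exact/forallP.
- rewrite (@eval_ext _ _ v) => [|i]; last by rewrite andbb.
  rewrite Cv /=; apply/negP => /andP[/forallP/(_ i0) vi0 /forallP/(_ i0)].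
  by rewrite vi0.
Qed.

Theorem theorem1 (n : nat) (C : circuit 'I_n) :
  ~ satisfiable C <->
  exists s : bits (n + n).+1, s != 0 /\ s \in V (computed (F C)).
Proof.
split=> [unsat|[s [s_neq0]]].
  have fE x : computed (F C) x = all_p_no_q x.
    rewrite computed_F; case: ifP => // _.
    case E: (eval _ C) => //; case: unsat.
    by exists (fun i => x (var_pi i) && x (var_qi i)).
  exists (point true xpred0 xpred0); split.
    by apply/eqP => /ffunP/(_ (var_p n)); rewrite point_p ffunE.
  rewrite inE; apply/forallP => x; rewrite !fE; apply/eqP.
  by congr (_ && _); apply: eq_forallb => i; rewrite ffunE pointE addr0.
rewrite inE => /forallP periodic sat.
have {}periodic (x : bits (n + n).+1) :
    computed (F C) (x + s) = computed (F C) x.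
  exact/eqP/periodic.
(* A translate by s landing in the half cube p = 1 has the same value of f, which is d there. *)
have shift_d (x : bits (n + n).+1) :
    (x + s)%R (var_p n) -> computed (F C) x -> all_p_no_q (x + s).
  by move=> xs_p; rewrite -periodic computed_F xs_p.
case s_p: (s (var_p n)).
  (* Both translates have p = 1 and satisfy d, so they coincide; cancelling s gives x = y. *)
  have [x [y [/eqP neq_xy eq_p x_p fx fy]]] := computed_F_two_points C sat.
  apply/neq_xy/(addIr s)/all_p_no_q_inj.
  - by apply: shift_d => //; rewrite ffunE x_p s_p.
  - by apply: shift_d => //; rewrite ffunE -eq_p x_p s_p.
  - by rewrite !ffunE eq_p.
(* Here s fixes p. Take for x the only point with p = 1 satisfying d: then x + s is that point as
   well, so s = 0. *)
pose x : bits (n + n).+1 := point true xpredT xpred0.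
have dx : all_p_no_q x.
  by rewrite all_p_no_q_point; apply/andP; split; apply/forallP.
have xs_p : (x + s) (var_p n) = true by rewrite ffunE point_p s_p.
case/eqP: s_neq0; apply: (addrI x); rewrite addr0.
apply: all_p_no_q_inj => //; last by rewrite xs_p point_p.
by apply: shift_d; rewrite ?xs_p // computed_F point_p.
Qed.
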